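(* Let $m\ge 3$ and let $u_1,\dots,u_m\in\mathbb{R}^2$ be the radius vectors of the vertices of a regular $m$-gon centered at the origin. Let $1\le r\le m-1$. If $r$ is odd, then $e_r(\mathcal{D}_{u_1},\dots,\mathcal{D}_{u_m})=0$. If $r=2j$ is even, then there is a nonzero constant $C$ such that $e_r(\mathcal{D}_{u_1},\dots,\mathcal{D}_{u_m})=C\,\Delta^j$, where $\Delta$ is the Laplace operator on $\mathbb{R}^2$.
   Context: Here $e_r$ is the $r$-th elementary symmetric polynomial in $m$ variables and $\mathcal{D}_u=u\cdot\nabla$ is the directional derivative along $u$. Equivalently, with $U$ the $m\times 2$ matrix with rows $u_1,\dots,u_m$, the polynomial $e_r(U\xi)$ in $\xi=(\xi_1,\xi_2)^T$ is $0$ for $r$ odd and $C(\xi_1^2+\xi_2^2)^j$ for $r=2j$. *)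

(* Defs.v *)
From HB Require Import structures.
From mathcomp Require Import all_boot all_order all_algebra all_fingroup.
From mathcomp Require Import all_classical all_reals all_analysis.
Import Order.TTheory GRing.Theory Num.Theory.
Import numFieldNormedType.Exports.

Set Implicit Arguments.
Unset Strict Implicit.
Unset Printing Implicit Defensive.

Local Open Scope classical_set_scope.
Local Open Scope ring_scope.

(* The m vertices of a regular m-gon centered at the origin, with arbitrary
   circumradius rho > 0, arbitrary rotation theta, and listed in an arbitrary
   order s. *)
Definition regular_polygon (R : realType) (m : nat) (u : 'I_m -> 'rV[R]_2) :=
  exists (rho theta : R) (s : {perm 'I_m}), 0 < rho /\
    forall k : 'I_m,
      let phi := theta + 2 * pi * (s k)%:R / m%:R in
      u k = \row_(i < 2) (if i == 0 then rho * cos phi else rho * sin phi).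

(* The derivative at x is the linear map v |-> 'D_v f x; on R^2 it is of
   class C^k as a function of x iff each x |-> 'D_v f x is. *)
Fixpoint class_C (R : realType) (k : nat) (f : 'rV[R]_2 -> R) : Prop :=
  if k is k'.+1 then
    (forall x, differentiable f x) /\ (forall v, class_C k' (fun x => 'D_v f x))
  else continuous f.

Definition smooth (R : realType) (f : 'rV[R]_2 -> R) : Prop :=
  forall k, class_C k f.

Definition dirD (R : realType) (u : 'rV[R]_2) (f : 'rV[R]_2 -> R) :
  'rV[R]_2 -> R := fun x => 'D_u f x.

(* The elementary symmetric polynomial e_r evaluated at the operators
   D_0, ..., D_(m-1), the product of operators being composition.  The factors
   of each product are composed in the order of the indices; this is
   immaterial for directional derivatives acting on smooth functions, which
   commute. *)
Definition esym_op (R : realType) (m r : nat)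
    (D : 'I_m -> ('rV[R]_2 -> R) -> ('rV[R]_2 -> R)) (f : 'rV[R]_2 -> R) :
  'rV[R]_2 -> R :=
  fun x => \sum_(A : {set 'I_m} | #|A| == r)
             (\big[comp/idfun]_(i in A) D i) f x.

Definition laplacian (R : realType) (f : 'rV[R]_2 -> R) : 'rV[R]_2 -> R :=
  fun x => \sum_(i < 2) dirD (delta_mx 0 i) (dirD (delta_mx 0 i) f) x.

(* Main.v *)
Require Import Defs.
From HB Require Import structures.
From mathcomp Require Import all_boot all_order all_algebra all_fingroup.
From mathcomp Require Import complex ring lra.
From mathcomp Require Import all_classical all_reals all_analysis.
Import Order.TTheory GRing.Theory Num.Theory.
Import numFieldNormedType.Exports.

Set Implicit Arguments.
Unset Strict Implicit.
Unset Printing Implicit Defensive.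

Local Open Scope ring_scope.

(* Directional derivatives commute on smooth functions, so the claim reduces to
   an identity between binary forms in (Dx, Dy), written dehomogenized as
   polynomials in X = Dx / Dy.  Over the complex numbers u_k . (X, 1) is
   a z^k + b z^-k with z a primitive m-th root of unity and
   a b = rho^2 (X^2 + 1) / 4, and
     \prod_k (1 - t (a z^k + b z^-k)) = L_m(- a b t^2) - t^m (a^m + b^m),
   where L_m is the Lucas polynomial, defined by
   L_m(- y y') = y^m + y'^m whenever y + y' = 1.  Comparing coefficients of t^r
   for r < m gives the result, the constant being nonzero because the
   coefficients of L_m are positive. *)

(** * Elementary symmetric sums as coefficients *)

Lemma horner_inj (F : numDomainType) (p q : {poly F}) :
  (forall x, p.[x] = q.[x]) -> p = q.
Proof.
move=> pq; apply/eqP; rewrite -subr_eq0; apply/eqP.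
(* The naturals below [size (p - q)] are distinct roots of [p - q], one too many for a nonzero
   polynomial. *)
apply: (@roots_geq_poly_eq0 _ _ [seq i%:R | i <- iota 0 (size (p - q))]).
- by apply/allP => x _; rewrite /root !hornerE pq subrr.
- by rewrite map_inj_uniq ?iota_uniq// => i j /eqP; rewrite eqr_nat => /eqP.
- by rewrite size_map size_iota.
Qed.

(** Expand the product: [A] is the set of factors from which the term in ['X] is taken. *)
Lemma coef_prod_1DZX (K : comNzRingType) (I : finType) (c : I -> K) (r : nat) :
  (\prod_k (1 + c k *: 'X))`_r =
  \sum_(A : {set I} | #|A| == r) \prod_(k in A) c k.
Proof.
under eq_bigr do rewrite addrC.
rewrite bigA_distr coef_sum [RHS]big_mkcond /=; apply: eq_bigr => A _.
rewrite -big_mkcond /= scaler_prod prodr_const coefZ coefXn eq_sym.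
by case: eqP; rewrite ?mulr1 ?mulr0.
Qed.

(** * Lucas polynomials *)

Fixpoint lucas_poly (F : nzRingType) (n : nat) : {poly F} :=
  match n with
  | 0 => 2%:R
  | 1 => 1
  | (n'.+1 as k).+1 => lucas_poly F k + 'X * lucas_poly F n'
  end.

Lemma lucas_polySS (F : nzRingType) n :
  lucas_poly F n.+2 = lucas_poly F n.+1 + 'X * lucas_poly F n.
Proof. by []. Qed.

Lemma nat_ind2 (P : nat -> Prop) : P 0%N -> P 1%N ->
  (forall n, P n -> P n.+1 -> P n.+2) -> forall n, P n.
Proof.
move=> P0 P1 PS n; suff: P n /\ P n.+1 by case.
by elim: n => // n [Pn PSn]; split => //; exact: PS.
Qed.

(** Used to bring the constant, computed over [R[i]], back to [R]. *)
Lemma map_lucas_poly (F K : nzRingType) (g : {rmorphism F -> K}) n :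
  map_poly g (lucas_poly F n) = lucas_poly K n.
Proof.
elim/nat_ind2: n => [||n IH0 IH1]; rewrite ?rmorph_nat ?rmorph1//.
by rewrite !lucas_polySS rmorphD rmorphM /= map_polyX IH0 IH1.
Qed.

(** As [y] and [z] are the roots of T^2 - T + y z, their power sums obey the recursion of
    [lucas_poly] at [- (y * z)]. *)
Lemma horner_lucas_poly (F : comNzRingType) (y z : F) n : y + z = 1 ->
  (lucas_poly F n).[- (y * z)] = y ^+ n + z ^+ n.
Proof.
move=> yz; elim/nat_ind2: n => [||n IH0 IH1].
- by rewrite /= -polyC_natr hornerC.
- by rewrite !hornerE.
rewrite lucas_polySS !hornerE IH0 IH1.
have -> : y = 1 - z by rewrite -yz addrK.
by rewrite !exprS; ring.
Qed.

(** All coefficients are nonnegative, so one positive summand of the recursion suffices: the first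
    for the constant term, the shifted one otherwise. *)
Lemma lucas_poly_coef_gt0 (F : numDomainType) n j : (j.*2 <= n)%N ->
  0 < (lucas_poly F n)`_j.
Proof.
have ge0 k i : 0 <= (lucas_poly F k)`_i.
  elim/nat_ind2: k i => [||k IH0 IH1] [|i].
  - by rewrite /= -polyC_natr coefC.
  - by rewrite /= -polyC_natr coefC.
  - by rewrite coef1.
  - by rewrite coef1.
  - by rewrite lucas_polySS coefD coefXM addr0.
  - by rewrite lucas_polySS coefD coefXM addr_ge0.
elim/nat_ind2: n j => [||n IH0 IH1] [|j] // jn.
- by rewrite /= -polyC_natr coefC.
- by rewrite coef1.
- by rewrite lucas_polySS coefD coefXM addr0 IH1.
- by rewrite lucas_polySS coefD coefXM ltr_wpDl ?IH0.
Qed.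

(** * Products over the powers of a primitive root of unity *)

Lemma prod_subr_prim (F : fieldType) m (z x y : F) : m.-primitive_root z ->
  \prod_(k < m) (x - y * z ^+ k) = x ^+ m - y ^+ m.
Proof.
move=> zm; have m0 := prim_order_gt0 zm.
have [->|y0] := eqVneq y 0.
  under eq_bigr do rewrite mul0r subr0.
  by rewrite prodr_const card_ord expr0n gtn_eqF// subr0.
(* Evaluate the factorization of X^m - 1 at [x / y] and multiply by [y ^+ m]. *)
have := factor_Xn_sub_1 zm; rewrite big_mkord => /(congr1 (horner^~ (x / y))).
rewrite /= horner_prod !hornerE => /(congr1 ( *%R (y ^+ m))).
rewrite mulrBr mulr1 expr_div_n [y ^+ m * (_ / _)]mulrC divfK ?expf_neq0// => <-.
have -> : y ^+ m = \prod_(k < m) y by rewrite prodr_const card_ord.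
rewrite -big_split /=; apply: eq_bigr => k _.
by rewrite !hornerE mulrBr [y * (_ / _)]mulrC divfK.
Qed.

(* For a root y of the quadratic with y + y' = 1 and y y' = a b, each factor
   splits as (y - a z^k) (y - b z^-k) / y. *)
Lemma prod_1B_prim (F : numClosedFieldType) m (z a b : F) :
  m.-primitive_root z ->
  \prod_(k < m) (1 - (a * z ^+ k + b * z ^- k)) =
  (lucas_poly F m).[- (a * b)] - (a ^+ m + b ^+ m).
Proof.
move=> zm.
have z0 : z != 0.
  apply/eqP => z0; have := prim_expr_order zm.
  by rewrite z0 expr0n gtn_eqF ?(prim_order_gt0 zm)// => /esym/eqP; rewrite oner_eq0.
have [y y0 yE] : exists2 y : F, y != 0 & a * b = y * (1 - y).
  pose s := sqrtC (1 - 4 * (a * b)).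
  have sE : s ^+ 2 = 1 - 4 * (a * b) by rewrite sqrtCK.
  have [s1|s1] := eqVneq (1 + s) 0; last first.
    exists ((1 + s) / 2); first by rewrite mulf_neq0// invr_eq0 pnatr_eq0.
    have -> : a * b = (1 - s ^+ 2) / 4 by rewrite sE; field.
    by field.
  (* Here [s = -1], so [a * b = 0] and the other root of the quadratic is 1. *)
  exists 1; first exact: oner_neq0.
  have se : s = -1 by apply/eqP; rewrite -subr_eq0 opprK addrC s1.
  have -> : a * b = (1 - s ^+ 2) / 4 by rewrite sE; field.
  by rewrite se; ring.
rewrite yE horner_lucas_poly; last by rewrite addrC subrK.
have -> : \prod_(k < m) (1 - (a * z ^+ k + b * z ^- k)) =
    \prod_(k < m) ((y - a * z ^+ k) * (y - b * z^-1 ^+ k) / y).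
  apply: eq_bigr => k _; rewrite exprVn; set w := z ^+ k.
  have w0 : w != 0 by rewrite expf_neq0.
  have -> : (y - a * w) * (y - b * w^-1) = y ^+ 2 + a * b - y * (a * w + b * w^-1).
    by field.
  by rewrite yE; field; rewrite w0 y0.
(* With [z^-1] primitive too, the factors in [b] multiply to [y ^+ m - b ^+ m]. *)
have zVm : m.-primitive_root z^-1.
  have -> : z^-1 = z ^+ m.-1.
    apply: (mulfI z0); rewrite mulfV// -exprS prednK ?prim_expr_order//.
    exact: prim_order_gt0 zm.
  by rewrite prim_root_exp_coprime// coprimePn// (prim_order_gt0 zm).
rewrite !big_split /= !prod_subr_prim//.
rewrite prodr_const card_ord exprVn.
have := congr1 (fun t => t ^+ m) yE; rewrite /= !exprMn.
have : y ^+ m != 0 by rewrite expf_neq0.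
move: (y ^+ m) (a ^+ m) (b ^+ m) ((1 - y) ^+ m) => Y A B Z Y0 E.
have -> : (Y - A) * (Y - B) = Y ^+ 2 + A * B - Y * (A + B) by ring.
by rewrite E; field.
Qed.


Lemma coef_comp_scaleX (F : comNzRingType) (p : {poly F}) c i :
  (p \Po (c *: 'X))`_i = c ^+ i * p`_i.
Proof.
rewrite comp_polyE coef_sum.
under eq_bigr do rewrite exprZn !coefZ coefXn.
have [ip|ip] := ltnP i (size p).
  rewrite (bigD1 (Ordinal ip)) //= eqxx big1 ?addr0 ?mulr1 1?mulrC// => k ki.
  by rewrite -(inj_eq val_inj) /= eq_sym in ki; rewrite (negbTE ki) !mulr0.
rewrite [p`_i]nth_default// mulr0 big1// => k _.
by rewrite gtn_eqF ?mulr0//; exact: leq_trans ip.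
Qed.

(** The generating product is a polynomial in ['X^2] up to a multiple of ['X^m], which [r < m]
    excludes. *)
Lemma esym_prim (F : numClosedFieldType) (m r : nat) (z a b : F) :
  m.-primitive_root z -> (r < m)%N ->
  \sum_(A : {set 'I_m} | #|A| == r)
    \prod_(k in A) (a * z ^+ k + b * z ^- k) =
  if odd r then 0 else (- (a * b)) ^+ r./2 * (lucas_poly F m)`_r./2.
Proof.
move=> zm rm; rewrite -coef_prod_1DZX.
have -> : \prod_(k < m) (1 + (a * z ^+ k + b * z ^- k) *: 'X) =
    (lucas_poly F m \Po (- (a * b) *: 'X)) \Po 'X^2 -
      ((- a) ^+ m + (- b) ^+ m) *: 'X^m.
  apply: horner_inj => t.
  rewrite horner_prod !(hornerE, horner_comp).
  rewrite -[X in _.[X]]mulrA /=.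
  have -> : - (a * b) * (t * t) = - ((- (a * t)) * (- (b * t))) by ring.
  (* The variable [t] is absorbed into [a] and [b]. *)
  have := prod_1B_prim (- (a * t)) (- (b * t)) zm.
  rewrite mulrDl -!exprMn !mulNr => <-.
  by apply: eq_bigr => k _; rewrite !hornerE; ring.
rewrite coefB coefZ coefXn ltn_eqF// mulr0 subr0 coef_comp_poly_Xn//.
by rewrite dvdn2 divn2 coef_comp_scaleX; case: (odd r).
Qed.

(** * Points of the unit circle as complex numbers *)

Section Cis.
Variable R : realType.
Implicit Types x y : R.
Local Open Scope complex_scope.

Definition cis x : R[i] := cos x +i* sin x.

Lemma cisD x y : cis (x + y) = cis x * cis y.
Proof. by rewrite /cis cosD sinD; congr (_ +i* _); rewrite /= [sin x * _ + _]addrC. Qed.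

Lemma cis0 : cis 0 = 1.
Proof. by rewrite /cis cos0 sin0. Qed.

Lemma cisMn x n : cis (x *+ n) = cis x ^+ n.
Proof. by elim: n => [|n IH]; rewrite ?mulr0n ?cis0// mulrS cisD IH exprS. Qed.

Lemma cisN x : cis (- x) = (cis x)^-1.
Proof.
apply: divr1_eq; rewrite invrK -cisD addNr; exact: cis0.
Qed.

(** If the order [k] were less than [m], then cos(2 pi k/m) = 1 would force sin(pi k/m) = 0,
    although pi k/m lies strictly between 0 and pi. *)
Lemma cis_prim m : (0 < m)%N -> m.-primitive_root (cis (2 * pi / m%:R)).
Proof.
move=> m0; have mR0 : (0 < m%:R :> R) by rewrite ltr0n.
have cism : cis (2 * pi / m%:R) ^+ m = 1.
  rewrite -cisMn.
  have -> : 2 * pi / m%:R *+ m = pi *+ 2 :> R.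
    by rewrite -[_ *+ m]mulr_natr divfK ?gt_eqF// mulr_natl.
  by rewrite /cis cos2pi sin2pi.
have [k km km'] := prim_order_exists m0 cism.
have [E|kNm] := eqVneq k m; first by rewrite E in km.
have k0 := prim_order_gt0 km.
have : (k < m)%N by rewrite ltn_neqAle kNm dvdn_leq.
rewrite -(ltr_nat R) => klt.
have kR0 : (0 < k%:R :> R) by rewrite ltr0n.
have := prim_expr_order km; rewrite -cisMn => /(congr1 (@complex.Re R)) /= .
have -> : 2 * pi / m%:R *+ k = (pi * (k%:R / m%:R)) *+ 2 :> R.
  by rewrite -[_ *+ k]mulr_natr -[_ *+ 2]mulr_natr; ring.
rewrite cos_mulr2n => /eqP.
have : 0 < sin (pi * (k%:R / m%:R) : R).
  rewrite sin_gt0_pi// mulr_gt0 ?pi_gt0 ?divr_gt0//=.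
  by rewrite gtr_pMr ?pi_gt0// ltr_pdivrMr// mul1r.
have := cos2Dsin2 (pi * (k%:R / m%:R) : R).
nra.
Qed.

End Cis.

(** * The elementary symmetric forms of a regular polygon *)

Lemma esym_perm (K : comNzRingType) (I : finType) (s : {perm I}) (c : I -> K) r :
  \sum_(A : {set I} | #|A| == r) \prod_(k in A) c (s k) =
  \sum_(A : {set I} | #|A| == r) \prod_(k in A) c k.
Proof.
rewrite -!coef_prod_1DZX [in RHS](reindex_inj (@perm_inj _ s)).
by [].
Qed.

Lemma esym_polygon (R : realType) (m r : nat) (u : 'I_m -> 'rV[R]_2) :
  regular_polygon u -> (r < m)%N -> exists2 C : R, C != 0 &
  \sum_(A : {set 'I_m} | #|A| == r)
    \prod_(k in A) (u k 0 0 *: 'X + (u k 0 1)%:P) =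
  if odd r then 0 else C *: ('X^2 + 1) ^+ r./2.
Proof.
move=> [rho [theta [s [rho0 us]]]] rm; have m0 : (0 < m)%N by exact: leq_trans rm.
(* Comes from [- (a * b) = - (rho ^+ 2 / 4) * (x ^+ 2 + 1)] for the [a], [b] below. *)
exists ((- (rho ^+ 2 / 4)) ^+ r./2 * (lucas_poly R m)`_r./2).
  rewrite mulf_neq0 ?expf_neq0 ?oppr_eq0 ?mulf_neq0 ?sqrf_eq0 ?gt_eqF//.
  apply: lucas_poly_coef_gt0.
  by rewrite (leq_trans _ (ltnW rm))// -[leqRHS]odd_double_half leq_addl.
apply: horner_inj => x; apply: (@complexI R).
(* For real [x], x cos phi + sin phi is half the sum of e^(i phi) (x - i) and its conjugate; [a] and
   [b] are these terms at [theta], scaled by [rho]. *)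
pose a : R[i] := (rho / 2)%:C%C * cis theta * Complex x (-1).
pose b : R[i] := (rho / 2)%:C%C * cis (- theta) * Complex x 1.
have -> : (if odd r then 0 else ((- (rho ^+ 2 / 4)) ^+ r./2 *
  (lucas_poly R m)`_r./2) *: ('X^2 + 1) ^+ r./2).[x]%:C%C =
  if odd r then 0 else (- (a * b)) ^+ r./2 * (lucas_poly R[i] m)`_r./2.
  case: (odd r); first by rewrite horner0.
  have -> : - (a * b) = (- (rho ^+ 2 / 4) * (x ^+ 2 + 1))%:C%C.
    have -> : a * b = (rho / 2)%:C%C ^+ 2 * (cis theta * cis (- theta)) *
        (Complex x (-1) * Complex x 1) by rewrite /a /b; ring.
    rewrite -cisD subrr cis0 mulr1; apply/eqP; rewrite eq_complex /=.
    by apply/andP; split; apply/eqP; field.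
  rewrite !hornerE -(map_lucas_poly (real_complex R)) coef_map /=.
  by rewrite -rmorphXn -rmorphM /= exprMn; congr (_%:C%C); ring.
(* [esym_perm] absorbs the arbitrary order of the vertices. *)
rewrite -(esym_prim a b (cis_prim R m0) rm) -[RHS](esym_perm s).
rewrite horner_sum rmorph_sum; apply: eq_bigr => A _.
rewrite horner_prod rmorph_prod; apply: eq_bigr => k _.
rewrite us !mxE /= !hornerE.
set t : R := 2 * pi * (s k)%:R / m%:R.
have -> : cis (2 * pi / m%:R : R) ^+ s k = cis t.
  by rewrite -cisMn; congr cis; rewrite /t -[_ *+ s k]mulr_natr; ring.
have -> : a * cis t + b * (cis t)^-1 = (rho / 2)%:C%C *
   (cis (theta + t) * Complex x (-1) + cis (- (theta + t)) * Complex x 1).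
  by rewrite opprD !cisD -[(cis t)^-1]cisN /a /b; ring.
move: (theta + t) => phi; apply/eqP; rewrite eq_complex /= cosN sinN.
by apply/andP; split; apply/eqP; field.
Qed.

(** * Calculus of directional derivatives on smooth functions *)

Section DirectionalDerivative.
Variable R : realType.
Notation V := 'rV[R]_2.
Implicit Types (f g : V -> R) (u v x : V).

Lemma is_derive_line f u x (t : R) : (forall y, differentiable f y) ->
  is_derive t (1 : R) (fun s => f (s *: u + x)) ('D_u f (t *: u + x)).
Proof.
move=> df.
have E : (fun h : R => h^-1 *: (((fun s => f (s *: u + x)) \o shift t) (h *: (1 : R))
      - f (t *: u + x))) =
    (fun h : R => h^-1 *: ((f \o shift (t *: u + x)) (h *: u) - f (t *: u + x))).
  by apply/funext => h /=; rewrite [h *: 1]mulr1 scalerDl addrA.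
apply: DeriveDef; last by rewrite /derive E.
by rewrite /derivable E; exact: diff_derivable.
Qed.

(** The mean value theorem is applied along [u] to the difference of [f] on two parallel segments,
    then along [v] to ['D_u f]. *)
Lemma mixed_difference_MVT f u v x (h : R) : 0 <= h ->
  (forall y, differentiable f y) -> (forall y, differentiable ('D_u f) y) ->
  exists s t : R, [/\ 0 <= s <= h, 0 <= t <= h &
    f (h *: u + (h *: v + x)) - (f (h *: u + x) + f (h *: v + x)) + f x =
    'D_v ('D_u f) (t *: v + (s *: u + x)) * h * h].
Proof.
move=> h0 df dDf.
have is1 (t : R) : is_derive t (1 : R)
    (fun s => f (s *: u + (h *: v + x)) - f (s *: u + x))
    ('D_u f (t *: u + (h *: v + x)) - 'D_u f (t *: u + x)).
  by apply: is_deriveB; exact: is_derive_line.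
have [|s sh E1] := MVT_segment h0 (fun t _ => is1 t).
  by apply: derivable_within_continuous => t _; exact: (@ex_derive _ _ _ _ _ _ _ (is1 t)).
have is2 (t : R) : is_derive t (1 : R)
    (fun t => 'D_u f (t *: v + (s *: u + x))) ('D_v ('D_u f) (t *: v + (s *: u + x))).
  exact: is_derive_line.
have [|t th E2] := MVT_segment h0 (fun t _ => is2 t).
  by apply: derivable_within_continuous => r _; exact: (@ex_derive _ _ _ _ _ _ _ (is2 r)).
exists s, t; split; [by rewrite !in_itv in sh| by rewrite !in_itv in th|].
move: E1 E2; rewrite !scale0r !add0r subr0 => E1 E2.
rewrite -E2 [h *: v + (s *: u + x)]addrCA -E1; ring.
Qed.

Lemma close_of_same_difference (S h p q p' q' e : R) : 0 < h ->
  S = p' * h * h -> S = q' * h * h ->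
  `|p - p'| < e / 2 -> `|q - q'| < e / 2 -> `|p - q| <= e.
Proof.
move=> /lt0r_neq0 h0 -> /(mulIf h0)/(mulIf h0) <-.
rewrite !ltr_norml ler_norml => /andP[? ?] /andP[? ?].
by apply/andP; split; lra.
Qed.

(** Schwarz's theorem: the mixed difference is symmetric in [u] and [v], so both iterated
    derivatives take a common value at points near [x]; continuity concludes. *)
Lemma derive_comm f u v x :
  (forall y, differentiable f y) ->
  (forall y, differentiable ('D_u f) y) -> (forall y, differentiable ('D_v f) y) ->
  {for x, continuous ('D_v ('D_u f))} -> {for x, continuous ('D_u ('D_v f))} ->
  'D_v ('D_u f) x = 'D_u ('D_v f) x.
Proof.
move=> df du dv cu cv; apply/eqP; rewrite -subr_eq0 -normr_le0.
apply/ler_addgt0Pl => e e0; rewrite addr0.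
have e2 : 0 < e / 2 by rewrite divr_gt0.
have /nbhs_ballP[d d0 xd] : nbhs x [set y | `|'D_v ('D_u f) x - 'D_v ('D_u f) y| < e / 2
    /\ `|'D_u ('D_v f) x - 'D_u ('D_v f) y| < e / 2]%classic.
  apply: filterI; [move/cvgrPdist_lt: cu | move/cvgrPdist_lt: cv]; exact.
(* Keeps every mean value point inside the ball of radius [d]; the [+ 1] makes the bound strict and
   the denominator positive. *)
pose h := d / (`|u| + `|v| + 1).
have uv0 : 0 < `|u| + `|v| + 1 by rewrite ltr_wpDl ?addr_ge0.
have h0 : 0 < h by rewrite divr_gt0.
have near_x (w w' : V) (s t : R) : `|w| + `|w'| = `|u| + `|v| ->
    0 <= s <= h -> 0 <= t <= h -> ball x d (t *: w + (s *: w' + x)).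
  move=> ww /andP[s0 sh] /andP[t0 th]; rewrite -ball_normE /ball_ /=.
  rewrite addrA opprD addrCA subrr addr0 normrN.
  rewrite (le_lt_trans (ler_normD _ _))// !normrZ !ger0_norm//.
  rewrite (@le_lt_trans _ _ (h * (`|u| + `|v|)))//.
    by rewrite -ww mulrDr lerD// ler_wpM2r.
  by rewrite /h mulrAC ltr_pdivrMr// ltr_pM2l// ltrDl.
clearbody h.
have [s [t [sh th E]]] := mixed_difference_MVT v x (ltW h0) df du.
have [s' [t' [sh' th' E']]] := mixed_difference_MVT u x (ltW h0) df dv.
have [/= U _] := xd _ (near_x v u s t (addrC _ _) sh th).
have [/= _ W] := xd _ (near_x u v s' t' erefl sh' th').
rewrite [h *: v + (h *: u + x)]addrCA [f (h *: v + x) + _]addrC in E'.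
exact: (close_of_same_difference h0 E E' U W).
Qed.

Lemma smooth_differentiable f x : smooth f -> differentiable f x.
Proof. by move=> /(_ 1%N)[]. Qed.

Lemma smooth_dirD u f : smooth f -> smooth (dirD u f).
Proof. by move=> sf k; have [_ /(_ u)] := sf k.+1. Qed.

Lemma smooth_continuous f : smooth f -> continuous f.
Proof. by move/(_ 0%N). Qed.

Lemma dirD_comm u v f : smooth f -> dirD v (dirD u f) = dirD u (dirD v f).
Proof.
move=> sf; apply/funext => x; apply: derive_comm => [y|y|y||].
- exact: smooth_differentiable.
- exact: (smooth_differentiable y (smooth_dirD u sf)).
- exact: (smooth_differentiable y (smooth_dirD v sf)).
- exact: (smooth_continuous (smooth_dirD v (smooth_dirD u sf))).
- exact: (smooth_continuous (smooth_dirD u (smooth_dirD v sf))).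
Qed.

Lemma dirDD u f g : smooth f -> smooth g -> dirD u (f + g) = dirD u f + dirD u g.
Proof.
move=> sf sg; apply/funext => x.
by apply: deriveD; exact/diff_derivable/smooth_differentiable.
Qed.

Lemma dirDZ u c f : smooth f -> dirD u (c *: f) = c *: dirD u f.
Proof.
move=> sf; apply/funext => x.
by apply: deriveZ; exact/diff_derivable/smooth_differentiable.
Qed.

Lemma dirD0 u : dirD u 0 = 0.
Proof. by apply/funext => x; exact: derive_cst. Qed.

Lemma smooth0 : smooth (0 : V -> R).
Proof.
elim=> [|k IH] /=.
  by move=> x; exact/differentiable_continuous/(differentiable_cst (0 : R) x).
split=> [x|v]; first exact: differentiable_cst.
by have := dirD0 v; rewrite /dirD => ->.
Qed.

Lemma smoothD f g : smooth f -> smooth g -> smooth (f + g).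
Proof.
move=> sf sg k; elim: k f g sf sg => [|k IH] f g sf sg.
  by move=> x; apply/differentiable_continuous/differentiableD; exact: smooth_differentiable.
split=> [x|v]; first by apply: differentiableD; exact: smooth_differentiable.
by have := dirDD v sf sg; rewrite /dirD => ->; apply: IH; exact: smooth_dirD.
Qed.

Lemma smoothZ c f : smooth f -> smooth (c *: f).
Proof.
move=> sf k; elim: k f sf => [|k IH] f sf.
  by move=> x; apply/differentiable_continuous/differentiableZ; exact: smooth_differentiable.
split=> [x|v]; first by apply: differentiableZ; exact: smooth_differentiable.
by have := dirDZ v c sf; rewrite /dirD => ->; apply: IH; exact: smooth_dirD.
Qed.

Lemma smooth_sum (I : Type) (r : seq I) (F : I -> V -> R) :
  (forall i, smooth (F i)) -> smooth (\sum_(i <- r) F i).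
Proof.
move=> sF; elim/big_ind: _ => //; [exact: smooth0|exact: smoothD].
Qed.

Lemma dirD_sum (I : Type) (r : seq I) (F : I -> V -> R) u :
  (forall i, smooth (F i)) ->
  dirD u (\sum_(i <- r) F i) = \sum_(i <- r) dirD u (F i).
Proof.
move=> sF; elim: r => [|i r IH]; first by rewrite !big_nil dirD0.
by rewrite !big_cons dirDD ?IH//; exact: smooth_sum.
Qed.

(** ['D_u f x] is the differential at [x] applied to [u], hence linear in [u]. *)
Lemma dirD_coord u f : smooth f ->
  dirD u f = u 0 0 *: dirD (delta_mx 0 0) f + u 0 1 *: dirD (delta_mx 0 1) f.
Proof.
move=> sf; apply/funext => x; rewrite /dirD.
have df := smooth_differentiable x sf.
rewrite [in LHS](row_sum_delta u) !big_ord_recl big_ord0 addr0.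
have -> : lift ord0 ord0 = 1 :> 'I_2 by exact/val_inj.
have E : (u 0 0 *: 'D_(delta_mx 0 0) f + u 0 1 *: 'D_(delta_mx 0 1) f) x =
   u 0 0 *: 'D_(delta_mx 0 0) f x + u 0 1 *: 'D_(delta_mx 0 1) f x by [].
by rewrite E !deriveE// linearD !linearZ.
Qed.

End DirectionalDerivative.

(** * Binary forms as constant-coefficient differential operators *)

Section HomogeneousOperator.
Variable R : realType.
Notation V := 'rV[R]_2.
Implicit Types (f g : V -> R) (u v x : V) (p q : {poly R}).
Local Notation Dx := (dirD (delta_mx 0 0 : V)).
Local Notation Dy := (dirD (delta_mx 0 1 : V)).

Lemma smooth_iter_dirD u n f : smooth f -> smooth (iter n (dirD u) f).
Proof. by move=> sf; elim: n => //= n IH; exact: smooth_dirD. Qed.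

Lemma iter_dirD_comm u v n f : smooth f ->
  dirD v (iter n (dirD u) f) = iter n (dirD u) (dirD v f).
Proof.
move=> sf; elim: n => //= n IH.
by rewrite dirD_comm ?IH//; exact: smooth_iter_dirD.
Qed.

(* The operator q(Dx, Dy), where q is the homogenization of p in degree r. *)
Definition homog_op (r : nat) p f : V -> R :=
  \sum_(i < r.+1) p`_i *: iter i Dx (iter (r - i) Dy f).

Lemma smooth_homog_op r p f : smooth f -> smooth (homog_op r p f).
Proof.
by move=> sf; apply: smooth_sum => i; exact/smoothZ/smooth_iter_dirD/smooth_iter_dirD.
Qed.

Lemma homog_opD r p q f : homog_op r (p + q) f = homog_op r p f + homog_op r q f.
Proof.
by rewrite /homog_op -big_split; apply: eq_bigr => i _; rewrite coefD scalerDl.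
Qed.

Lemma homog_opZ r c p f : homog_op r (c *: p) f = c *: homog_op r p f.
Proof.
by rewrite /homog_op scaler_sumr; apply: eq_bigr => i _; rewrite coefZ scalerA.
Qed.

Lemma homog_op0 r f : homog_op r 0 f = 0.
Proof. by rewrite /homog_op big1// => i _; rewrite coef0 scale0r. Qed.

Lemma homog_op_sum (I : Type) (s : seq I) (P : pred I) r (p : I -> {poly R}) f :
  homog_op r (\sum_(i <- s | P i) p i) f = \sum_(i <- s | P i) homog_op r (p i) f.
Proof.
by apply: (big_morph (fun q => homog_op r q f)) => [q q'|];
  [exact: homog_opD|exact: homog_op0].
Qed.

(** Composing operators multiplies forms: ['X] adds a [Dx], while a constant adds a [Dy] through the
    rise in degree. *)
Lemma dirD_homog_op u r p f : smooth f -> (size p <= r.+1)%N ->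
  dirD u (homog_op r p f) = homog_op r.+1 ((u 0 0 *: 'X + (u 0 1)%:P) * p) f.
Proof.
move=> sf pr.
have sm i : smooth (iter i Dx (iter (r - i) Dy f)).
  exact/smooth_iter_dirD/smooth_iter_dirD.
rewrite /homog_op dirD_sum; last by move=> i; exact: smoothZ.
transitivity (\sum_(i < r.+1) p`_i *: (u 0 0 *: iter i.+1 Dx (iter (r - i) Dy f)
    + u 0 1 *: iter i Dx (iter (r.+1 - i) Dy f))).
  apply: eq_bigr => i _; rewrite dirDZ// dirD_coord//; congr (_ *: (_ + _ *: _)).
  (* The new [Dy] moves past the [Dx] to join the other [Dy]. *)
  rewrite iter_dirD_comm; last exact: smooth_iter_dirD.
  by rewrite subSn// -ltnS.
under eq_bigr do rewrite scalerDr !scalerA.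
rewrite big_split /=.
under [RHS]eq_bigr do rewrite mulrDl coefD -scalerAl coefZ coefXM mul_polyC coefZ
  scalerDl.
rewrite big_split /=; congr (_ + _).
  rewrite [RHS]big_ord_recl /= mulr0 scale0r add0r.
  by apply: eq_bigr => i _; rewrite /= mulrC subSS.
(* The extra top coefficient of [p] vanishes by the size bound. *)
rewrite [RHS]big_ord_recr /= nth_default// mulr0 scale0r addr0.
by apply: eq_bigr => i _; rewrite mulrC.
Qed.

Lemma homog_op1 f : homog_op 0 1 f = f.
Proof. by rewrite /homog_op big_ord1 coef1 scale1r. Qed.

Lemma size_linear_mul (c d : R) p r : (size p <= r)%N ->
  (size ((c *: 'X + d%:P) * p)%R <= r.+1)%N.
Proof.
move=> pr; rewrite (leq_trans (size_polyMleq _ _))//.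
have : (size (c *: 'X + d%:P)%R <= 2)%N.
  rewrite (leq_trans (size_polyD _ _))// geq_max size_polyC.
  by rewrite (leq_trans (size_scale_leq _ _)) ?size_polyX//; case: (d != 0).
move=> h; have := leq_add h pr; case: (_ + _)%N => //.
Qed.

Lemma big_comp_dirD m (u : 'I_m -> V) (s : seq 'I_m) f : smooth f ->
  (\big[comp/idfun]_(k <- s) dirD (u k)) f =
  homog_op (size s) (\prod_(k <- s) (u k 0 0 *: 'X + (u k 0 1)%:P)) f.
Proof.
move=> sf; elim: s => [|k s IH]; first by rewrite !big_nil homog_op1.
have sz (t : seq 'I_m) :
    (size (\prod_(k <- t) (u k 0 0 *: 'X + (u k 0 1)%:P))%R <= (size t).+1)%N.
  elim: t => [|k' t IHt]; first by rewrite big_nil size_poly1.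
  by rewrite big_cons size_linear_mul.
by rewrite !big_cons /= IH dirD_homog_op.
Qed.

(** Every composition in e_r has [r] factors, so all the forms share the degree [r] and can be
    added. *)
Lemma esym_op_dirD m r (u : 'I_m -> V) f : smooth f ->
  esym_op r (fun k => dirD (u k)) f =
  homog_op r (\sum_(A : {set 'I_m} | #|A| == r)
    \prod_(k in A) (u k 0 0 *: 'X + (u k 0 1)%:P)) f.
Proof.
move=> sf; rewrite homog_op_sum; apply/funext => x; rewrite /esym_op fct_sumE.
apply: eq_bigr => A /eqP Ar.
rewrite -[in LHS]big_filter big_comp_dirD// -sum1_size !big_filter sum1_card Ar.
by [].
Qed.

Lemma laplacianE f : laplacian f = Dx (Dx f) + Dy (Dy f).
Proof.
apply/funext => x; rewrite /laplacian big_ord_recl big_ord1.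
by have -> : lift ord0 ord0 = 1 :> 'I_2 by exact/val_inj.
Qed.

Lemma iter_laplacian j f : smooth f ->
  iter j (@laplacian R) f = homog_op (2 * j) (('X^2 + 1) ^+ j) f.
Proof.
move=> sf; elim: j => [|j IH]; first by rewrite homog_op1.
have sz : (size (('X^2 + 1 : {poly R}) ^+ j)%R <= (2 * j).+1)%N.
  elim: j {IH} => [|j IH]; first by rewrite size_poly1.
  rewrite exprS mulrDl mul1r (leq_trans (size_polyD _ _))// geq_max.
  rewrite (leq_trans IH) ?ltnS ?leq_mul2l ?leqnSn// andbT.
  rewrite (leq_trans (size_polyMleq _ _))// size_polyXn addSn /= mulnS -addnS.
  by rewrite leq_add2l.
rewrite iterS IH laplacianE.
(* Two [Dx] multiply the polynomial by ['X^2], two [Dy] by 1; both raise the degree by 2. *)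
rewrite dirD_homog_op// dirD_homog_op ?size_linear_mul//.
rewrite dirD_homog_op// dirD_homog_op ?size_linear_mul//.
rewrite -homog_opD mulnS; congr (homog_op _ _ _).
rewrite !mxE /= !scale1r !scale0r polyC0 polyC1 [RHS]exprS.
ring.
Qed.

End HomogeneousOperator.

Theorem mainTheorem3 (R : realType) (m r : nat) (u : 'I_m -> 'rV[R]_2)
    (hm : (3 <= m)%N) (hu : regular_polygon u) (hr : (1 <= r <= m - 1)%N) :
  (odd r ->
     forall f : 'rV[R]_2 -> R, smooth f ->
       forall x, esym_op r (fun i => dirD (u i)) f x = 0) /\
  (forall j : nat, r = (2 * j)%N ->
     exists C : R, C != 0 /\
       forall f : 'rV[R]_2 -> R, smooth f ->
         forall x,
           esym_op r (fun i => dirD (u i)) f x = C * iter j (@laplacian R) f x).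
Proof.
have rm : (r < m)%N.
  by case/andP: hr => _; rewrite -ltnS subn1 prednK// (leq_trans _ hm).
(* [C] is fixed before [f], so it serves every smooth function. *)
have [C C0 eC] := esym_polygon hu rm.
split=> [ro f sf x|j rj].
  by rewrite esym_op_dirD// eC ro homog_op0.
exists C; split=> // f sf x.
rewrite esym_op_dirD// eC iter_laplacian// rj mul2n odd_double doubleK.
by rewrite homog_opZ.
Qed.
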